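(* Let $\mathbf J=(T,S)$ be a frame. Let $\mathbb S$ denote the category of sup-semilattices and $F\text{-}\mathbb S_{\leq}$ the category of $F$-sup-semilattices and lax morphisms. Then: (a) For an arbitrary $F$-sup-semilattice $\mathbf H=(\mathbf G,F)$ there exists a lax morphism of $F$-sup-semilattices $\eta_{\mathbf H}\colon\mathbf H\to(\mathbf J\otimes\mathbf H)^{\mathbf J}$ defined by $(\eta_{\mathbf H}(x))(i)=\mathrm n(j[\mathbf J,\mathbf H])(x_{i=})$ for $x\in G$, $i\in T$. Moreover, $\eta=(\eta_{\mathbf H})_{\mathbf H\in F\text{-}\mathbb S_{\leq}}$ is a natural transformation from the identity functor on $F\text{-}\mathbb S_{\leq}$ to the endofunctor $(\mathbf J\otimes-)^{\mathbf J}$. (b) For an arbitrary sup-semilattice $\mathbf L$ there exists a unique sup-semilattice morphism $\varepsilon_{\mathbf L}\colon\mathbf J\otimes\mathbf L^{\mathbf J}\to\mathbf L$ such that $\varepsilon_{\mathbf L}\circ\mathrm n(j[\mathbf J,\mathbf L^{\mathbf J}])=e_{\mathbf L}$, where $e_{\mathbf L}\colon(\mathbf L^T)^T\to\mathbf L$ is defined by $e_{\mathbf L}(\bar x)=\bigvee_{i\in T}(\bar x(i))(i)$ for $\bar x\in(\mathbf L^T)^T$. Moreover, $\varepsilon=(\varepsilon_{\mathbf L})_{\mathbf L\in\mathbb S}$ is a natural transformation from the endofunctor $\mathbf J\otimes(-)^{\mathbf J}$ to the identity functor on $\mathbb S$. (c) There is an adjoint situation $(\eta,\varepsilon)\colon(\mathbf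 J\otimes-)\dashv(-^{\mathbf J})\colon\mathbb S\to F\text{-}\mathbb S_{\leq}$; that is, $\mathbf J\otimes-\colon F\text{-}\mathbb S_{\leq}\to\mathbb S$ is left adjoint to $-^{\mathbf J}\colon\mathbb S\to F\text{-}\mathbb S_{\leq}$ with unit $\eta$ and counit $\varepsilon$.
   Context: A sup-semilattice is a poset in which every subset has a join (bottom element $0$); morphisms of sup-semilattices are maps preserving arbitrary joins. An $F$-sup-semilattice is a pair $(\mathbf G,F)$ where $\mathbf G$ is a sup-semilattice and $F\colon G\to G$ preserves arbitrary joins. A lax morphism of $F$-sup-semilattices $(\mathbf G_1,F_1)\to(\mathbf G_2,F_2)$ is a sup-semilattice morphism $f$ with $F_2(f(x))\leq f(F_1(x))$ for all $x\in G_1$. A frame $\mathbf J=(T,S)$ is a set $T$ with a binary relation $S\subseteq T^2$. Functor $-^{\mathbf J}\colon\mathbb S\to F\text{-}\mathbb S_{\leq}$: $\mathbf L^{\mathbf J}=(\mathbf L^T,F^{\mathbf J})$, where $\mathbf L^T$ is the set of maps $T\to L$ with pointwise order and $(F^{\mathbf J}(x))(i)=\bigvee\{x(k)\mid(i,k)\in S\}$; on morphisms, $(f^{\mathbf J}(x))(i)=f(x(i))$. Functor $\mathbf J\otimes-\colon F\text{-}\mathbb S_{\leq}\to\mathbb S$: Let $\mathbf H=(\mathbf G,F)$ be an $F$-sup-semilattice. For $x\in G$, $i\in T$ let $x_{iS}\in G^T$ be given by $x_{iS}(k)=x$ if $(i,k)\in S$ and $x_{iS}(k)=0$ otherwise;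 let $x_{i=}\in G^T$ be given by $x_{i=}(i)=x$ and $x_{i=}(k)=0$ for $k\neq i$. Put $[\mathbf J,\mathbf H]=\{(x_{iS}\vee F(x)_{i=},\,F(x)_{i=})\mid x\in G,\ i\in T\}\subseteq(G^T)^2$. Define $j=j[\mathbf J,\mathbf H]\colon G^T\to G^T$ by $$j(a)=a\vee\bigvee\{c\in G^T\mid\text{there is }d\leq a\text{ with }(c,d)\in[\mathbf J,\mathbf H]\text{ or }(d,c)\in[\mathbf J,\mathbf H]\}.$$ Then $\mathbf J\otimes\mathbf H$ is the set $\{a\in G^T\mid j(a)=a\}$ with the order inherited from $\mathbf G^T$, and $\mathrm n(j)\colon G^T\to\mathbf J\otimes\mathbf H$ is the closure operator $\mathrm n(j)(a)=\bigwedge\{x\in G^T\mid j(x)=x,\ a\leq x\}$. $\mathbf J\otimes\mathbf H$ is a sup-semilattice whose join of a subset $M$ is $\mathrm n(j)(\bigvee M)$ with $\bigvee M$ computed in $\mathbf G^T$. For a lax morphism $f\colon\mathbf H_1\to\mathbf H_2$ with $\mathbf H_m=(\mathbf G_m,F_m)$, $\mathbf J\otimes f$ is the unique sup-semilattice morphism $\mathbf J\otimes\mathbf H_1\to\mathbf J\otimes\mathbf H_2$ with $(\mathbf J\otimes f)\circ\mathrm n(j[\mathbf J,\mathbf H_1])=\mathrm n(j[\mathbf J,\mathbf H_2])\circ f^{\mathbf J}$, where $f^{\mathbf J}\colon\mathbf G_1^T\to\mathbf G_2^T$ applies $f$ coordinatewise. *)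

(* Defs.v *)
From HB Require Import structures.
From mathcomp Require Import all_boot all_order.
From mathcomp Require Import boolp classical_sets.

Set Implicit Arguments.
Unset Strict Implicit.
Unset Printing Implicit Defensive.

Import Order.TTheory.
Local Open Scope classical_set_scope.
Local Open Scope order_scope.

(* Joins of arbitrary subsets; [bigjoin] is determined by the order since
   [supremums A] has at most one element. *)
HB.mixin Record hasBigJoins d (L : Type) of Order.POrder d L := {
  bigjoin : set L -> L;
  bigjoin_supremums : forall A : set L, supremums A (bigjoin A)
}.

#[short(type="supSemilatticeType")]
HB.structure Definition SupSemilattice d :=
  { L of Order.POrder d L & hasBigJoins d L }.

Section SupSemilatticeTheory.
Context (d : Order.disp_t) (L : supSemilatticeType d).
Implicit Types (A : set L) (x y : L).

Definition join2 x y : L := bigjoin [set x; y].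
Definition bottom : L := bigjoin set0.
Definition bigmeet A : L := bigjoin (lbound A).

Lemma bigjoin_ub A x : A x -> x <= bigjoin A.
Proof. by have [+ _] := bigjoin_supremums A; apply. Qed.

Lemma bigjoin_le A y : (forall x, A x -> x <= y) -> bigjoin A <= y.
Proof. by have [_] := bigjoin_supremums A; apply. Qed.

Lemma bigjoin_eq A y : ubound A y -> (forall z, ubound A z -> y <= z) ->
  bigjoin A = y.
Proof.
move=> ub lub; apply/eqP; rewrite eq_le bigjoin_le//=; apply: lub => x.
exact: bigjoin_ub.
Qed.

Lemma bottom_le x : bottom <= x.
Proof. by apply: bigjoin_le => y []. Qed.

Lemma join2_ubl x y : x <= join2 x y.
Proof. by apply: bigjoin_ub; left. Qed.

Lemma join2_ubr x y : y <= join2 x y.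
Proof. by apply: bigjoin_ub; right. Qed.

Lemma join2_le x y z : x <= z -> y <= z -> join2 x y <= z.
Proof. by move=> xz yz; apply: bigjoin_le => t [->|->]. Qed.

Lemma bigmeet_lb A x : A x -> bigmeet A <= x.
Proof. by move=> Ax; apply: bigjoin_le => y; apply. Qed.

Lemma bigmeet_ge A y : (forall x, A x -> y <= x) -> y <= bigmeet A.
Proof. by move=> yA; apply: bigjoin_ub. Qed.

End SupSemilatticeTheory.

Arguments bottom {d L}.

(* The order on [T -> L] is the pointwise one declared in [boolp]. *)
Lemma fun_leP (T : Type) d (L : porderType d) (f g : T -> L) :
  reflect (forall i, f i <= g i) (f <= g).
Proof. exact: asboolP. Qed.

Section Power.
Context (T : Type) (d : Order.disp_t) (L : supSemilatticeType d).

Definition fun_bigjoin (A : set (T -> L)) : T -> L :=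
  fun i => bigjoin [set a i | a in A].

Lemma fun_bigjoin_supremums A : supremums A (fun_bigjoin A).
Proof.
split=> [a Aa|b ub]; apply/fun_leP => i.
  by apply: bigjoin_ub; exists a.
by apply: bigjoin_le => _ [a Aa <-]; move/fun_leP: (ub a Aa).
Qed.

HB.instance Definition _ :=
  hasBigJoins.Build FunOrder.fun_display (T -> L) fun_bigjoin_supremums.

End Power.

Definition preserves_joins d d' (L : supSemilatticeType d)
    (M : supSemilatticeType d') (f : L -> M) :=
  forall A : set L, f (bigjoin A) = bigjoin (f @` A).

Lemma preserves_joins_homo d d' (L : supSemilatticeType d)
    (M : supSemilatticeType d') (f : L -> M) :
  preserves_joins f -> {homo f : x y / x <= y}.
Proof.
move=> fP x y xy.
have -> : y = bigjoin [set x; y].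
  by apply/esym/bigjoin_eq => [z [->|->]//|z]; apply; right.
by rewrite fP; apply: bigjoin_ub; exists x => //; left.
Qed.

Lemma preserves_joins0 d d' (L : supSemilatticeType d)
    (M : supSemilatticeType d') (f : L -> M) :
  preserves_joins f -> f bottom = bottom.
Proof. by move=> fP; rewrite fP image_set0. Qed.

Lemma preserves_joins_comp d d' d'' (L : supSemilatticeType d)
    (M : supSemilatticeType d') (N : supSemilatticeType d'')
    (g : M -> N) (f : L -> M) :
  preserves_joins g -> preserves_joins f -> preserves_joins (g \o f).
Proof. by move=> gP fP A /=; rewrite fP gP image_comp. Qed.

Lemma preserves_joins_id d (L : supSemilatticeType d) :
  preserves_joins (@id L).
Proof. by move=> A; rewrite image_id. Qed.

Record category := Category {
  object :> Type;
  hom : object -> object -> Type;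
  idm : forall x, hom x x;
  compm : forall x y z, hom y z -> hom x y -> hom x z;
  compm_id_l : forall x y (f : hom x y), compm (idm y) f = f;
  compm_id_r : forall x y (f : hom x y), compm f (idm x) = f;
  compmA : forall x y z t (h : hom z t) (g : hom y z) (f : hom x y),
    compm h (compm g f) = compm (compm h g) f
}.
Arguments hom {c}.
Arguments idm {c} x.
Arguments compm {c x y z}.

Record functor (C D : category) := Functor {
  fobj :> C -> D;
  fmap : forall x y : C, hom x y -> hom (fobj x) (fobj y);
  fmap_id : forall x, fmap (idm x) = idm (fobj x);
  fmap_comp : forall x y z (g : hom y z) (f : hom x y),
    fmap (compm g f) = compm (fmap g) (fmap f)
}.
Arguments fmap {C D} _ {x y}.

Definition functor_id (C : category) : functor C C.
Proof. by exists id (fun _ _ f => f). Defined.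

Definition functor_comp (C D E : category) (G : functor D E)
  (F : functor C D) : functor C E.
Proof.
exists (fun x => G (F x)) (fun _ _ f => fmap G (fmap F f)).
- by move=> x; rewrite !fmap_id.
- by move=> x y z g f; rewrite !fmap_comp.
Defined.

Definition natural (C D : category) (F G : functor C D)
    (t : forall x : C, hom (F x) (G x)) :=
  forall (x y : C) (f : hom x y),
    compm (t y) (fmap F f) = compm (fmap G f) (t x).
Arguments natural {C D} F G t.

(* [F] is the left adjoint, [eta] the unit and [eps] the counit; the last two
   clauses are the triangle identities. *)
Definition adjoint_situation (C D : category) (F : functor C D)
    (G : functor D C) (eta : forall x : C, hom x (G (F x)))
    (eps : forall y : D, hom (F (G y)) y) :=
  [/\ natural (functor_id C) (functor_comp G F) eta,
      natural (functor_comp F G) (functor_id D) eps,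
      forall y : D, compm (fmap G (eps y)) (eta (G y)) = idm (G y)
    & forall x : C, compm (eps (F x)) (fmap F (eta x)) = idm (F x)].
Arguments adjoint_situation {C D} F G eta eps.

Record supsl := SupSl {
  supsl_disp : Order.disp_t;
  supsl_sort :> supSemilatticeType supsl_disp
}.

Record sup_hom (L M : supsl) := SupHom {
  sup_fun :> L -> M;
  sup_funP : preserves_joins sup_fun
}.

Lemma sup_hom_ext (L M : supsl) (f g : sup_hom L M) : f =1 g -> f = g.
Proof.
by case: f g => [f fP] [g gP] /= /funext fg; subst g; congr SupHom.
Qed.

Definition sup_id (L : supsl) : sup_hom L L :=
  SupHom (@preserves_joins_id _ L).
Definition sup_comp (L M N : supsl) (g : sup_hom M N) (f : sup_hom L M) :
  sup_hom L N := SupHom (preserves_joins_comp (sup_funP g) (sup_funP f)).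

Definition Sup : category.
Proof. by exists supsl sup_hom sup_id sup_comp => *; exact: sup_hom_ext.
Defined.

Record fsupsl := FSupSl {
  fsupsl_sort :> supsl;
  fop : fsupsl_sort -> fsupsl_sort;
  fopP : preserves_joins fop
}.
Arguments fop : clear implicits.

Record lax_hom (H K : fsupsl) := LaxHom {
  lax_sup :> sup_hom H K;
  lax_homP : forall x : H, fop K (lax_sup x) <= lax_sup (fop H x)
}.

Lemma lax_hom_ext (H K : fsupsl) (f g : lax_hom H K) : f =1 g -> f = g.
Proof.
case: f g => [f fP] [g gP] /= fg.
by have := sup_hom_ext fg => fg'; subst g; congr LaxHom.
Qed.

Lemma lax_id_subproof (H : fsupsl) (x : H) :
  fop H (sup_id H x) <= sup_id H (fop H x).
Proof. exact: lexx. Qed.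

Definition lax_id (H : fsupsl) : lax_hom H H := LaxHom (@lax_id_subproof H).

Lemma lax_comp_subproof (H K M : fsupsl) (g : lax_hom K M) (f : lax_hom H K)
    (x : H) : fop M (sup_comp g f x) <= sup_comp g f (fop H x).
Proof.
apply: le_trans (lax_homP g (f x)) _.
exact/(preserves_joins_homo (sup_funP g))/lax_homP.
Qed.

Definition lax_comp (H K M : fsupsl) (g : lax_hom K M) (f : lax_hom H K) :
  lax_hom H M := LaxHom (lax_comp_subproof g f).

Definition FSup : category.
Proof. by exists fsupsl lax_hom lax_id lax_comp => *; exact: lax_hom_ext.
Defined.

Record frame := Frame {
  point :> Type;
  acc : set (point * point)
}.
Arguments acc : clear implicits.

Section PowerFunctor.
Context (J : frame).

(* $F^J$ *)
Definition power_op (L : supsl) (x : J -> L) : J -> L :=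
  fun i => bigjoin [set x k | k in [set k | acc J (i, k)]].

Lemma power_op_joins (L : supsl) : preserves_joins (@power_op L).
Proof.
move=> A; apply/esym/bigjoin_eq => [_ [a Aa <-]|z ub]; apply/fun_leP => i.
  apply: bigjoin_le => _ [k ik <-].
  apply: (@le_trans _ _ (bigjoin A k)); first by apply: bigjoin_ub; exists a.
  by apply: bigjoin_ub; exists k.
apply: bigjoin_le => _ [k ik <-]; apply: bigjoin_le => _ [a Aa <-].
apply: (@le_trans _ _ (power_op a i)); first by apply: bigjoin_ub; exists k.
by have /fun_leP := ub (power_op a) (imageP _ Aa).
Qed.

Definition power_obj (L : supsl) : fsupsl :=
  @FSupSl (SupSl (J -> L)) (@power_op L) (@power_op_joins L).

Lemma power_map_joins (L M : supsl) (f : sup_hom L M) :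
  preserves_joins (fun (x : J -> L) (i : J) => f (x i)).
Proof.
move=> A; apply/funext => i.
rewrite [X in f X]/bigjoin/= /fun_bigjoin sup_funP.
rewrite [RHS]/bigjoin/= /fun_bigjoin.
by rewrite !image_comp.
Qed.

Definition power_sup_map (L M : supsl) (f : sup_hom L M) :
    sup_hom (SupSl (J -> L)) (SupSl (J -> M)) :=
  @SupHom (SupSl (J -> L)) (SupSl (J -> M))
    (fun x i => f (x i)) (power_map_joins f).

Lemma power_map_lax (L M : supsl) (f : sup_hom L M) (x : power_obj L) :
  fop (power_obj M) (power_sup_map f x)
    <= power_sup_map f (fop (power_obj L) x).
Proof.
apply/fun_leP => i /=.
by rewrite /power_op sup_funP image_comp.
Qed.

Definition power_map (L M : supsl) (f : sup_hom L M) :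
    lax_hom (power_obj L) (power_obj M) :=
  @LaxHom (power_obj L) (power_obj M) (power_sup_map f) (power_map_lax f).

Definition power : functor Sup FSup.
Proof. by exists power_obj power_map => *; exact: lax_hom_ext. Defined.

End PowerFunctor.

Fact tensor_display : Order.disp_t. Proof. exact: Order.Disp tt tt. Qed.

Section Tensor.
Context (J : frame) (H : fsupsl).
Implicit Types (a b : J -> H) (x : H) (i k : J).

(* $x_{iS}$ and $x_{i=}$ *)
Definition at_succ x i : J -> H :=
  fun k => if `[< acc J (i, k) >] then x else bottom.
Definition at_point x i : J -> H :=
  fun k => if `[< k = i >] then x else bottom.

Definition tensor_rel : set ((J -> H) * (J -> H)) :=
  [set p | exists x i,
     p = (join2 (at_succ x i) (at_point (fop H x) i), at_point (fop H x) i)].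

Definition jmap a : J -> H :=
  join2 a (bigjoin [set c | exists2 d, d <= a &
                                tensor_rel (c, d) \/ tensor_rel (d, c)]).

(* $n(j)$, as a map into $G^T$ *)
Definition nucleus a : J -> H := bigmeet [set b | jmap b = b /\ a <= b].

Record tensor_sort := Tensor {
  tensor_val : J -> H;
  tensor_valP : jmap tensor_val == tensor_val
}.
HB.instance Definition _ := [isSub for tensor_val].
HB.instance Definition _ := [Choice of tensor_sort by <:].
HB.instance Definition _ :=
  [SubChoice_isSubPOrder of tensor_sort by <: with tensor_display].

Lemma tensor_leE (u v : tensor_sort) : (u <= v) = (val u <= val v).
Proof. by []. Qed.

Lemma jmap_homo : {homo jmap : a b / a <= b}.
Proof.
move=> a b ab; apply: join2_le; first exact: le_trans ab (join2_ubl _ _).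
apply: le_trans (join2_ubr _ _); apply: bigjoin_le => c [e ea ec].
by apply: bigjoin_ub; exists e => //; exact: le_trans ea ab.
Qed.

Lemma nucleus_ge a : a <= nucleus a.
Proof. by apply: bigmeet_ge => b []. Qed.

Lemma nucleus_le a b : jmap b = b -> a <= b -> nucleus a <= b.
Proof. by move=> jb ab; apply: bigmeet_lb. Qed.

Lemma nucleus_fixed a : jmap (nucleus a) == nucleus a.
Proof.
rewrite eq_le join2_ubl andbT; apply: bigmeet_ge => b [jb ab].
by rewrite -[leRHS]jb; apply: jmap_homo; exact: nucleus_le.
Qed.

(* $n(j)$, as a map into $J \otimes H$ *)
Definition tensor_proj a : tensor_sort :=
  Tensor (nucleus_fixed a).

Definition tensor_bigjoin (M : set tensor_sort) : tensor_sort :=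
  tensor_proj (bigjoin (val @` M)).

Lemma tensor_bigjoin_supremums M : supremums M (tensor_bigjoin M).
Proof.
split=> [u Mu|v ub]; rewrite tensor_leE /=.
  by apply: le_trans (nucleus_ge _); apply: bigjoin_ub; exists u.
apply: nucleus_le; first exact/eqP/(valP v).
by apply: bigjoin_le => _ [u Mu <-]; rewrite -tensor_leE; exact: ub.
Qed.

HB.instance Definition _ := hasBigJoins.Build tensor_display
  tensor_sort tensor_bigjoin_supremums.

(* $J \otimes H$ *)
Definition tensor_obj : supsl := SupSl tensor_sort.

Lemma tensor_projK (u : tensor_sort) : tensor_proj (val u) = u.
Proof.
apply/val_inj/eqP; rewrite eq_le nucleus_ge andbT.
exact/nucleus_le/lexx/eqP/(valP u).
Qed.

Lemma tensor_proj_le a (u : tensor_sort) : (tensor_proj a <= u) = (a <= val u).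
Proof.
rewrite tensor_leE; apply/idP/idP; first exact: le_trans (nucleus_ge _).
exact/nucleus_le/eqP/(valP u).
Qed.

Lemma tensor_proj_joins : preserves_joins tensor_proj.
Proof.
move=> A; apply/esym/bigjoin_eq => [_ [a Aa <-]|v ub].
  rewrite tensor_proj_le; apply: le_trans (nucleus_ge _).
  exact: bigjoin_ub.
rewrite tensor_proj_le; apply: bigjoin_le => a Aa.
by rewrite -tensor_proj_le; apply: ub; exists a.
Qed.

Lemma at_succ_le x i a : (forall k, acc J (i, k) -> x <= a k) ->
  at_succ x i <= a.
Proof.
move=> xa; apply/fun_leP => k; rewrite /at_succ.
by case: asboolP => [/xa//|_]; exact: bottom_le.
Qed.

Lemma at_point_le x i a : x <= a i -> at_point x i <= a.
Proof.
move=> xa; apply/fun_leP => k; rewrite /at_point.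
by case: asboolP => [->//|_]; exact: bottom_le.
Qed.

Lemma at_succE x i k : acc J (i, k) -> at_succ x i k = x.
Proof. by move=> ik; rewrite /at_succ asboolT. Qed.

Lemma at_pointE x i : at_point x i i = x.
Proof. by rewrite /at_point asboolT. Qed.

Lemma jmap_fixedP b : jmap b = b <->
  forall x i, fop H x <= b i -> forall k, acc J (i, k) -> x <= b k.
Proof.
split=> [jb x i xb k ik|bP].
  have pb : at_point (fop H x) i <= b by exact: at_point_le.
  suff : join2 (at_succ x i) (at_point (fop H x) i) <= b.
    move=> /(le_trans (join2_ubl _ _))/fun_leP/(_ k).
    by rewrite at_succE.
  rewrite -[leRHS]jb; apply: le_trans (join2_ubr _ _).
  apply: bigjoin_ub; exists (at_point (fop H x) i) => //.
  by left; exists x, i.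
apply/eqP; rewrite eq_le join2_ubl andbT; apply: join2_le => //.
apply: bigjoin_le => c [e eb [|] [x [i [E1 E2]]]]; last first.
  by rewrite E2; apply: le_trans eb; rewrite E1 join2_ubr.
rewrite E1 -E2; apply: join2_le => //; apply: at_succ_le; apply: bP.
by move/fun_leP/(_ i): eb; rewrite E2 at_pointE.
Qed.

End Tensor.

Section TensorFunctor.
Context (J : frame).

(* $J \otimes f$; by [tensor_mapP] it is the unique sup-semilattice morphism
   that commutes with the projections. *)
Definition tensor_fun (H K : fsupsl) (f : lax_hom H K) :
    tensor_obj J H -> tensor_obj J K :=
  fun u => tensor_proj (power_sup_map J f (val u)).

Lemma tensor_fun_proj (H K : fsupsl) (f : lax_hom H K) (a : J -> H) :
  tensor_fun f (tensor_proj a) = tensor_proj (power_sup_map J f a).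
Proof.
apply/eqP; rewrite eq_le; apply/andP; split; last first.
  rewrite tensor_proj_le; apply: le_trans (nucleus_ge _).
  apply: (preserves_joins_homo (sup_funP (power_sup_map J f))).
  exact: nucleus_ge.
set v := tensor_proj (power_sup_map J f a).
pose b : J -> H := fun k => bigjoin [set y | f y <= val v k].
have fb k : f (b k) <= val v k.
  by rewrite sup_funP; apply: bigjoin_le => _ [y yv <-].
have jb : jmap b = b.
  apply/jmap_fixedP => x i xb k ik; apply: bigjoin_ub => /=.
  have /eqP/jmap_fixedP jv := valP v.
  apply: (jv _ i) => //; apply: le_trans (fb i).
  apply: le_trans (lax_homP f x) _.
  exact: (preserves_joins_homo (sup_funP f)).
have ab : a <= b.
  apply/fun_leP => k; apply: bigjoin_ub => /=.
  by have /fun_leP/(_ k) := nucleus_ge (power_sup_map J f a).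
rewrite tensor_proj_le; apply/fun_leP => k; apply: le_trans (fb k).
apply: (preserves_joins_homo (sup_funP f)).
by move: k; apply/fun_leP; exact: nucleus_le.
Qed.

Lemma tensor_fun_joins (H K : fsupsl) (f : lax_hom H K) :
  preserves_joins (tensor_fun f).
Proof.
move=> M; rewrite [X in tensor_fun f X]/bigjoin/= /tensor_bigjoin.
rewrite tensor_fun_proj (sup_funP (power_sup_map J f)) tensor_proj_joins.
by rewrite !image_comp.
Qed.

Definition tensor_map (H K : fsupsl) (f : lax_hom H K) :
    sup_hom (tensor_obj J H) (tensor_obj J K) :=
  SupHom (tensor_fun_joins f).

Lemma tensor_mapP (H K : fsupsl) (f : lax_hom H K) :
  unique (fun g : sup_hom (tensor_obj J H) (tensor_obj J K) =>
            g \o @tensor_proj J H = @tensor_proj J K \o power_sup_map J f)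
         (tensor_map f).
Proof.
split=> [|g gP]; first by apply/funext => a; exact: tensor_fun_proj.
apply: sup_hom_ext => u; rewrite -[u in RHS]tensor_projK.
by move/(congr1 (@^~ (val u))): gP => /= ->.
Qed.

Definition tensor : functor FSup Sup.
Proof.
exists (tensor_obj J) tensor_map.
- by move=> H; apply: sup_hom_ext => u; exact: tensor_projK.
- move=> H K M g f; apply: sup_hom_ext => u /=.
  exact/esym/tensor_fun_proj.
Defined.

End TensorFunctor.

Definition eval_diag (J : frame) (L : supsl) (x : J -> J -> L) : L :=
  bigjoin [set x i i | i in [set: J]].

(* Main.v *)
Require Import Defs.
From mathcomp Require Import all_boot all_order.
From mathcomp Require Import boolp classical_sets.

(* The map [x |-> x_{i=}] preserves joins, and [n(j)] forces [x_{k=}] below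
   [F(x)_{i=}] whenever [(i, k)] is in [S]; this is the laxness of the unit.
   Conversely a join-preserving map [e] on [G^T] that respects these
   inequalities factors through [n(j)], because the largest [b] with
   [e b <= e a] is then a fixed point of [j].  The diagonal join is such a map,
   which gives the counit, and the triangle identities follow from
   [e (x_{i=}) = x(i)] and from [a] being the join of the [a(i)_{i=}]. *)

Set Implicit Arguments.
Unset Strict Implicit.
Unset Printing Implicit Defensive.

Import Order.TTheory.
Local Open Scope classical_set_scope.
Local Open Scope order_scope.

Section Unit.
Context (J : frame) (H : fsupsl).

(** For fixed [i], this makes [at_point] left adjoint to evaluation at [i]; the next two lemmas
    follow from it. *)
Lemma at_point_leE (x : H) (i : J) (a : J -> H) :
  (at_point x i <= a) = (x <= a i).
Proof.
apply/idP/idP; last exact: at_point_le.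
by move=> /fun_leP/(_ i); rewrite at_pointE.
Qed.

Lemma at_point_joins (i : J) : preserves_joins (fun x : H => at_point x i).
Proof.
move=> A; apply/esym/bigjoin_eq => [_ [x Ax <-]|a ub].
  by rewrite at_point_leE at_pointE; exact: bigjoin_ub.
rewrite at_point_leE; apply: bigjoin_le => x Ax.
by rewrite -at_point_leE; apply: ub; exists x.
Qed.

Lemma bigjoin_at_point (a : J -> H) :
  bigjoin [set at_point (a i) i | i in [set: J]] = a.
Proof.
apply: bigjoin_eq => [_ [i _ <-]|b ub]; first by rewrite at_point_leE.
by apply/fun_leP => i; rewrite -at_point_leE; apply: ub; exists i.
Qed.

Definition unit_fun (x : H) : power J (tensor J H) :=
  fun i => tensor_proj (at_point x i).

Lemma unit_fun_joins : preserves_joins unit_fun.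
Proof.
move=> A; apply/funext => i.
rewrite /unit_fun at_point_joins tensor_proj_joins image_comp.
by rewrite [RHS]/bigjoin/= /fun_bigjoin image_comp.
Qed.

Definition unit_sup : sup_hom H (power J (tensor J H)) :=
  SupHom unit_fun_joins.

Lemma tensor_proj_at_point_le (x : H) (i k : J) : acc J (i, k) ->
  tensor_proj (at_point x k) <= tensor_proj (at_point (fop H x) i).
Proof.
move=> ik; rewrite tensor_proj_le at_point_leE.
(* A fixed point of [jmap] above [fop H x] at [i] is above [x] at every successor of [i]. *)
have /eqP/jmap_fixedP fixed := valP (tensor_proj (at_point (fop H x) i)).
by apply: fixed ik; rewrite -at_point_leE; exact: nucleus_ge.
Qed.

Lemma unit_lax (x : H) :
  fop (power J (tensor J H)) (unit_sup x) <= unit_sup (fop H x).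
Proof.
apply/fun_leP => i; apply: bigjoin_le => _ [k ik <-].
exact: tensor_proj_at_point_le.
Qed.

Definition tensor_unit : lax_hom H (power J (tensor J H)) := LaxHom unit_lax.

End Unit.

(** Away from [i] this is [f bottom = bottom]. Naturality of the unit reduces to it. *)
Lemma power_sup_map_at_point (J : frame) (H K : fsupsl) (f : sup_hom H K)
    (x : H) (i : J) :
  power_sup_map J f (at_point x i) = at_point (f x) i.
Proof.
apply/funext => k; rewrite /= /at_point.
by case: asboolP => // _; rewrite (preserves_joins0 (sup_funP f)).
Qed.

Lemma tensor_unit_natural (J : frame) :
  natural (functor_id FSup) (functor_comp (power J) (tensor J))
    (@tensor_unit J).
Proof.
move=> H K f; apply: lax_hom_ext => x; apply/funext => i /=.
rewrite /unit_fun tensor_fun_proj; congr tensor_proj.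
exact/esym/power_sup_map_at_point.
Qed.

Lemma nucleus_inv (J : frame) (H : fsupsl) d (L : supSemilatticeType d)
    (e : (J -> H) -> L) : preserves_joins e ->
    (forall x i k, acc J (i, k) ->
       e (at_point x k) <= e (at_point (fop H x) i)) ->
  forall a, e (nucleus a) = e a.
Proof.
move=> eP eS a; have e_homo := preserves_joins_homo eP.
apply/eqP; rewrite eq_le (e_homo _ _ (nucleus_ge a)) andbT.
pose b := bigjoin [set c | e c <= e a].
have eb : e b <= e a by rewrite eP; apply: bigjoin_le => _ [c ca <-].
have ab : a <= b by apply: bigjoin_ub; exact: lexx.
suff jb : jmap b = b by exact: le_trans (e_homo _ _ (nucleus_le jb ab)) eb.
(* It suffices that [at_point x k] is one of the joinands of [b]; its image under [e] is bounded
   through [e (at_point (fop H x) i)] and [e b]. *)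
apply/jmap_fixedP => x i; rewrite -at_point_leE => xb k ik.
rewrite -at_point_leE; apply: bigjoin_ub.
exact: le_trans (eS _ _ _ ik) (le_trans (e_homo _ _ xb) eb).
Qed.

Section Counit.
Context (J : frame) (L : supsl).

(** Joins commute: both sides are the join of all [x i i] with [x] in [A] and [i] in [J]. *)
Lemma eval_diag_joins : preserves_joins (@eval_diag J L).
Proof.
move=> A; apply/esym/bigjoin_eq => [_ [x Ax <-]|z ub].
  apply: bigjoin_le => _ [i _ <-].
  apply: (@le_trans _ _ (bigjoin A i i)); last by apply: bigjoin_ub; exists i.
  by apply/fun_leP; move: i; apply/fun_leP; exact: bigjoin_ub.
apply: bigjoin_le => _ [i _ <-]; apply: bigjoin_le => _ [_ [x Ax <-] <-].
apply: (@le_trans _ _ (eval_diag x)); first by apply: bigjoin_ub; exists i.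
by apply: ub; exists x.
Qed.

Lemma eval_diag_at_point (x : power J L) (i : J) :
  eval_diag (at_point x i) = x i.
Proof.
apply: bigjoin_eq => [_ [k _ <-]|z ub].
  rewrite /at_point; case: asboolP => [->//|_].
  (* Here [bottom] is a map [J -> L]; its value at [k] is a join over the image of the empty set. *)
  by apply: bigjoin_le => _ [_ [] _].
by apply: ub; exists i => //; rewrite at_pointE.
Qed.

Lemma eval_diag_nucleus (x : J -> power J L) :
  eval_diag (nucleus x) = eval_diag x.
Proof.
apply: (nucleus_inv (H := power J L) eval_diag_joins) => y i k ik.
(* After evaluation, [y k] is a joinand of [power_op y i]. *)
by rewrite !eval_diag_at_point; apply: bigjoin_ub; exists k.
Qed.

Definition counit_fun (u : tensor J (power J L)) : L := eval_diag (val u).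

Lemma counit_fun_joins : preserves_joins counit_fun.
Proof.
(* A join in the tensor is the nucleus of a pointwise join, and [eval_diag] does not see the
   nucleus. *)
move=> M; rewrite [LHS]eval_diag_nucleus eval_diag_joins.
by rewrite image_comp.
Qed.

Definition tensor_counit : sup_hom (tensor J (power J L)) L :=
  SupHom counit_fun_joins.

Lemma tensor_counitP :
  unique (fun g : sup_hom (tensor J (power J L)) L =>
            g \o @tensor_proj J (power J L) = @eval_diag J L) tensor_counit.
Proof.
split=> [|g gP]; first by apply/funext => x; exact: eval_diag_nucleus.
(* Uniqueness holds because [tensor_proj] is surjective. *)
apply: sup_hom_ext => u; rewrite -[u in RHS]tensor_projK.
by move/(congr1 (@^~ (val u))): gP => /= ->.
Qed.

End Counit.

Lemma tensor_counit_natural (J : frame) :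
  natural (functor_comp (tensor J) (power J)) (functor_id Sup)
    (@tensor_counit J).
Proof.
move=> L M f; apply: sup_hom_ext => u /=.
rewrite /counit_fun /= eval_diag_nucleus /eval_diag sup_funP.
by rewrite image_comp.
Qed.

Lemma tensor_power_adjoint (J : frame) :
  adjoint_situation (tensor J) (power J) (@tensor_unit J) (@tensor_counit J).
Proof.
split; [exact: tensor_unit_natural|exact: tensor_counit_natural| |].
- move=> L; apply: lax_hom_ext => x; apply/funext => i /=.
  by rewrite /counit_fun /= eval_diag_nucleus eval_diag_at_point.
- move=> H; apply: sup_hom_ext => u /=.
  (* The left side becomes the join of the classes of [at_point (val u i) i], which is the class of
     their join [val u]. *)
  rewrite /counit_fun /= eval_diag_nucleus -[RHS]tensor_projK.
  rewrite -[in RHS](bigjoin_at_point (val u)) tensor_proj_joins.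
  by rewrite image_comp.
Qed.

Theorem theorem4p1 (J : frame) :
  exists eta : forall H : fsupsl, lax_hom H (power J (tensor J H)),
    ((forall (H : fsupsl) (x : H) (i : J),
        eta H x i = tensor_proj (at_point x i)) /\
     natural (functor_id FSup) (functor_comp (power J) (tensor J)) eta) /\
  exists eps : forall L : supsl, sup_hom (tensor J (power J L)) L,
    ((forall L : supsl,
        unique (fun g : sup_hom (tensor J (power J L)) L =>
                  g \o @tensor_proj J (power J L) = @eval_diag J L)
               (eps L)) /\
     natural (functor_comp (tensor J) (power J)) (functor_id Sup) eps) /\
    adjoint_situation (tensor J) (power J) eta eps.
Proof.
exists (@tensor_unit J); split.
  by split=> //; exact: tensor_unit_natural.
exists (@tensor_counit J); split; last exact: tensor_power_adjoint.
by split; [exact: tensor_counitP|exact: tensor_counit_natural].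
Qed.
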